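(* Let $t$, $d$, $N$ be positive integers. If there is a weighted spherical $t$-design of size $N$ in $\mathbb{R}^d$, then there is a weighted Gaussian $t$-design in $\mathbb{R}^d$ with at most $(t+1)N$ points.
   Context: Let $\mu$ be the Lebesgue (surface) measure on the unit sphere $S^{d-1}\subset\mathbb{R}^d$ normalized so that $\mu(S^{d-1})=1$, and let $\rho$ be the Gaussian probability measure $d\rho=e^{-\pi|x|^2}\,dx$ on $\mathbb{R}^d$. A weighted spherical $t$-design in $\mathbb{R}^d$ is a finite set $X\subset S^{d-1}$ with a weight function $w\colon X\to\mathbb{R}_{>0}$ such that $\sum_{x\in X}w(x)f(x)=\int_{S^{d-1}}f\,d\mu$ for every polynomial $f$ of total degree at most $t$. A weighted Gaussian $t$-design in $\mathbb{R}^d$ is a finite set $X\subset\mathbb{R}^d$ with a weight function $w\colon X\to\mathbb{R}_{>0}$ such that $\sum_{x\in X}w(x)f(x)=\int_{\mathbb{R}^d}f\,d\rho$ for every polynomial $f$ of total degree at most $t$. *)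

(* Defs.v *)
From HB Require Import structures.
From mathcomp Require Import all_boot all_order all_algebra finmap.
From mathcomp Require mpoly.
(* The notations of mpoly clash with those of mathcomp-analysis, hence
   [mpoly d R] for {mpoly R[d]} and [meval v p] for p.@[v] below. *)
Import -(notations) mpoly.
From mathcomp Require Import all_classical all_reals all_analysis.
From mathcomp Require Import measurable_realfun measurable_fun_approximation.

Set Implicit Arguments.
Unset Strict Implicit.
Unset Printing Implicit Defensive.

Import Order.TTheory GRing.Theory Num.Theory.
Import numFieldNormedType.Exports.

Local Open Scope classical_set_scope.
Local Open Scope ring_scope.

(* R^n is [n.-tuple R], whose canonical sigma-algebra is the product of the
   Borel sigma-algebras of the factors. *)

Section lebesgue_rn.
Context {R : realType}.

Definition rn_cons n (p : measurableTypeR R * n.-tuple R) : n.+1.-tuple R :=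
  [tuple of p.1 :: p.2].

(* The n-fold product of the Lebesgue measure on R. *)
Fixpoint lebesgue_rn n : set (n.-tuple R) -> \bar R :=
  match n with
  | 0 => \d_([tuple] : 0.-tuple R)
  | n'.+1 => pushforward (lebesgue_measure \x @lebesgue_rn n')%E (@rn_cons n')
  end.

Lemma measurable_rn_cons n : measurable_fun setT (@rn_cons n).
Proof. by apply: measurable_cons; [exact: measurable_fst|exact: measurable_snd]. Qed.

Let uncons n (t : n.+1.-tuple R) : measurableTypeR R * n.-tuple R :=
  (thead t, [tuple of behead t]).

Let measurable_uncons n : measurable_fun setT (@uncons n).
Proof.
apply: measurable_fun_pair; last exact: measurable_behead.
exact: (measurable_tnth ord0).
Qed.

Let rn_consK n : cancel (@rn_cons n) (@uncons n).
Proof.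
move=> [x t]; rewrite /uncons /rn_cons /=; congr pair.
exact/val_inj.
Qed.

Let is_sigma_finite_measure n (m : set (n.-tuple R) -> \bar R) :=
  [/\ m set0 = 0%E, forall A, (0 <= m A)%E, semi_sigma_additive m &
      sigma_finite setT m].

Let lebesgue_rn_step n (m : {sigma_finite_measure set (n.-tuple R) -> \bar R}) :
  is_sigma_finite_measure (pushforward (lebesgue_measure \x m)%E (@rn_cons n)).
Proof.
pose M : {measure set _ -> \bar R} := (lebesgue_measure \x m)%E.
have H := @measurable_rn_cons n.
pose PM : {measure set (n.+1.-tuple R) -> \bar R} :=
  measure_function_pushforward__canonical__measure_function_Measure M H.
split.
- exact: (measure0 PM).
- exact: (measure_ge0 PM).
- exact: (@measure_semi_sigma_additive _ _ _ PM).
have /sigma_finiteP[F1 [F1T F1nd F1oo]] := sigma_finiteT (lebesgue_measure : {sigma_finite_measure set (measurableTypeR R) -> \bar R}).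
have /sigma_finiteP[G [GT Gnd Goo]] := sigma_finiteT m.
exists (fun k => @uncons n @^-1` (F1 k `*` G k)).
  rewrite -preimage_bigcup; apply/esym; rewrite -(preimage_setT (@uncons n)).
  congr (_ @^-1` _); apply/seteqP; split => // -[x y] _.
  have : [set: measurableTypeR R] x by [].
  have : [set: n.-tuple R] y by [].
  rewrite F1T GT => -[k _ Gky] [l _ Fly]; exists (maxn k l) => //; split => /=.
    by move: Fly; exact/subsetPset/F1nd/leq_maxr.
  by move: Gky; exact/subsetPset/Gnd/leq_maxl.
move=> k; have [mF Fk] := F1oo k; have [mG Gk] := Goo k; split.
  by rewrite -[X in measurable X]setTI; apply: (@measurable_uncons n) => //; exact: measurableX.
rewrite /pushforward -comp_preimage (_ : _ \o _ = id); last first.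
  by apply/funext => x /=; rewrite rn_consK.
by rewrite preimage_id product_measure1E// lte_mul_pinfty// ge0_fin_numE.
Qed.

Let lebesgue_rn_sigma_finite_measure n : is_sigma_finite_measure (@lebesgue_rn n).
Proof.
elim: n => [|n [m0 mge0 madd mfin]].
  split=> [|A||] /=.
  - exact: measure0.
  - exact: measure_ge0.
  - exact: measure_semi_sigma_additive.
  - exact: sigma_finiteT.
pose h1 := isMeasure.Build _ _ _ (@lebesgue_rn n) m0 mge0 madd.
pose m : {measure set (n.-tuple R) -> \bar R} := HB.pack (@lebesgue_rn n) h1.
pose h2 := Measure_isSigmaFinite.Build _ _ _ m mfin.
pose m' : {sigma_finite_measure set (n.-tuple R) -> \bar R} :=
  HB.pack (@lebesgue_rn n) h1 h2.
exact: (lebesgue_rn_step m').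
Qed.

Let lebesgue_rn0 n : lebesgue_rn (set0 : set (n.-tuple R)) = 0%E.
Proof. by have [] := lebesgue_rn_sigma_finite_measure n. Qed.

Let lebesgue_rn_ge0 n (A : set (n.-tuple R)) : (0 <= lebesgue_rn A)%E.
Proof. by have [] := lebesgue_rn_sigma_finite_measure n. Qed.

Let lebesgue_rn_semi_sigma_additive n : semi_sigma_additive (@lebesgue_rn n).
Proof. by have [] := lebesgue_rn_sigma_finite_measure n. Qed.

HB.instance Definition _ n := isMeasure.Build _ _ _ (@lebesgue_rn n)
  (@lebesgue_rn0 n) (@lebesgue_rn_ge0 n) (@lebesgue_rn_semi_sigma_additive n).

Let lebesgue_rn_sigma_finite n : sigma_finite setT (@lebesgue_rn n).
Proof. by have [] := lebesgue_rn_sigma_finite_measure n. Qed.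

HB.instance Definition _ n := Measure_isSigmaFinite.Build _ _ _
  (@lebesgue_rn n) (@lebesgue_rn_sigma_finite n).

End lebesgue_rn.

Section euclidean.
Context {R : realType} {d : nat}.
Implicit Types (x u : d.-tuple R) (A : set (d.-tuple R)).

Definition norm2 x : R := Num.sqrt (\sum_(i < d) tnth x i ^+ 2).

Definition scale_rn (r : R) x : d.-tuple R := [tuple r * tnth x i | i < d].

Definition unit_sphere : set (d.-tuple R) := [set x | norm2 x = 1].

Definition cone A : set (d.-tuple R) :=
  [set x | exists2 r : R, 0 < r <= 1 & exists2 u, A u & x = scale_rn r u].

Lemma measurable_norm2 : measurable_fun setT norm2.
Proof.
rewrite (_ : norm2 = fun x => (\sum_(i < d) tnth x i ^+ 2) `^ 2^-1).
  apply: (measurableT_comp (f := @powR R ^~ 2^-1)); first exact: measurable_powR.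
  apply: measurable_sum => i; apply: measurable_funX; exact: measurable_tnth.
by apply/funext => x; rewrite powR12_sqrt// sumr_ge0// => i _; exact: sqr_ge0.
Qed.

Lemma measurable_unit_sphere : measurable unit_sphere.
Proof.
rewrite (_ : unit_sphere = norm2 @^-1` [set 1])//.
by rewrite -[X in measurable X]setTI; exact: measurable_norm2.
Qed.

Let norm2_scale r u : 0 < r -> norm2 (scale_rn r u) = r * norm2 u.
Proof.
move=> r0; rewrite /norm2; under eq_bigr do rewrite tnth_mktuple exprMn.
by rewrite -mulr_sumr sqrtrM ?sqr_ge0// sqrtr_sqr gtr0_norm.
Qed.

Let scaleA r s u : scale_rn r (scale_rn s u) = scale_rn (r * s) u.
Proof. by apply: eq_from_tnth => i; rewrite !tnth_mktuple mulrA. Qed.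

Let scale1 u : scale_rn 1 u = u.
Proof. by apply: eq_from_tnth => i; rewrite !tnth_mktuple mul1r. Qed.

Let cone_sphereE A : cone (A `&` unit_sphere) =
  [set x | norm2 x \in `]0, 1]] `&`
  (fun x => scale_rn (norm2 x)^-1 x) @^-1` (A `&` unit_sphere).
Proof.
apply/seteqP; split=> [_ [r /andP[r0 r1] [u [Au Su] ->]]|x []] /=.
  rewrite norm2_scale// Su mulr1 in_itv /= r0 r1 scaleA mulVf ?gt_eqF// scale1.
  by split.
rewrite in_itv /= => n01 ASx; exists (norm2 x) => //.
exists (scale_rn (norm2 x)^-1 x) => //.
by rewrite scaleA divff ?scale1//; case/andP: n01 => /gt_eqF ->.
Qed.

Lemma measurable_cone A : measurable A -> measurable (cone (A `&` unit_sphere)).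
Proof.
move=> mA; rewrite cone_sphereE; apply: measurableI.
  rewrite (_ : [set _ | _] = norm2 @^-1` `]0, 1])//.
  by rewrite -[X in measurable X]setTI; apply: measurable_norm2.
rewrite -[X in measurable X]setTI.
apply: (_ : measurable_fun setT (fun x => scale_rn (norm2 x)^-1 x)) => //.
  apply/measurable_fun_tnthP => i /=.
  rewrite (_ : _ \o _ = fun x => norm2 x `^ (-1) * tnth x i).
    apply: measurable_funM; last exact: measurable_tnth.
    by apply: (measurableT_comp (f := @powR R ^~ (-1))); last exact: measurable_norm2.
  by apply/funext => x /=; rewrite tnth_mktuple powR_inv1// sqrtr_ge0.
by apply: measurableI => //; exact: measurable_unit_sphere.
Qed.

(* By integration in polar coordinates, the surface area of A `<=` S^(d-1)
   is d times the volume of {r u | 0 < r <= 1, u \in A}. *)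
Definition surface_measure A : \bar R :=
  (d%:R%:E * lebesgue_rn (cone (A `&` unit_sphere)))%E.

Let surface_measure0 : surface_measure set0 = 0%E.
Proof.
rewrite /surface_measure set0I (_ : cone set0 = set0) ?measure0 ?mule0//.
by apply/seteqP; split=> // x [r _ [u []]].
Qed.

Let surface_measure_ge0 A : (0 <= surface_measure A)%E.
Proof. by rewrite /surface_measure mule_ge0// lee_fin. Qed.

Let cone_bigcup (F : (set (d.-tuple R))^nat) :
  cone (\bigcup_k F k `&` unit_sphere) =
  \bigcup_k cone (F k `&` unit_sphere).
Proof.
rewrite setI_bigcupl; apply/seteqP; split=> [x [r r01 [u [k _ Fu] ->]]|].
  by exists k => //; exists r => //; exists u.
by move=> x [k _ [r r01 [u Fu ->]]]; exists r => //; exists u => //; exists k.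
Qed.

Let surface_measure_semi_sigma_additive : semi_sigma_additive surface_measure.
Proof.
move=> F mF tF mUF; rewrite /surface_measure cone_bigcup.
rewrite [X in X @ \oo --> _](_ : _ = fun n => (d%:R%:E *
    \sum_(0 <= i < n) lebesgue_rn (cone (F i `&` unit_sphere)))%E); last first.
  by apply/funext => n; rewrite ge0_sume_distrr.
apply: cvgeZl => //; apply: measure_semi_sigma_additive.
- by move=> k; exact: measurable_cone.
- apply/trivIsetP => i j _ _ ij; apply/seteqP; split=> // x [].
  rewrite !cone_sphereE => -[_ [Fi _]] [_ [Fj _]].
  have := conj Fi Fj.
  rewrite -[_ /\ _]/((F i `&` F j) (scale_rn (norm2 x)^-1 x)).
  by move/trivIsetP : tF => /(_ _ _ I I ij) ->.
- by rewrite -cone_bigcup; exact: measurable_cone.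
Qed.

HB.instance Definition _ := isMeasure.Build _ _ _ surface_measure
  surface_measure0 surface_measure_ge0 surface_measure_semi_sigma_additive.

Let inv_surface_ge0 : 0 <= (fine (surface_measure unit_sphere))^-1.
Proof. by rewrite invr_ge0 fine_ge0. Qed.

(* The surface measure normalized to total mass 1. *)
Definition sphere_measure : set (d.-tuple R) -> \bar R :=
  mscale (NngNum inv_surface_ge0) surface_measure.

HB.instance Definition _ := Measure.on sphere_measure.

(* The probability measure of density e^(-pi |x|^2). *)
Definition gaussian_measure A : \bar R :=
  (\int[@lebesgue_rn R d]_(x in A) (expR (- pi * norm2 x ^+ 2))%:E)%E.

Let gaussian_measure0 : gaussian_measure set0 = 0%E.
Proof. exact: integral_set0. Qed.

Let gaussian_measure_ge0 A : (0 <= gaussian_measure A)%E.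
Proof. by apply: integral_ge0 => x _; rewrite lee_fin expR_ge0. Qed.

Let gaussian_measure_semi_sigma_additive : semi_sigma_additive gaussian_measure.
Proof.
move=> F mF tF mUF; rewrite /gaussian_measure ge0_integral_bigcup//=.
- apply: is_cvg_ereal_nneg_natsum_cond => n _ _.
  exact: gaussian_measure_ge0.
- apply/measurable_funTS/measurable_EFinP; apply: measurableT_comp => //.
  apply: measurable_funM => //; apply: measurable_funX; exact: measurable_norm2.
Qed.

HB.instance Definition _ := isMeasure.Build _ _ _ gaussian_measure
  gaussian_measure0 gaussian_measure_ge0 gaussian_measure_semi_sigma_additive.

End euclidean.

Arguments unit_sphere {R} d.

(* [w] is only relevant on [X]; [msize p] is 1 + the total degree of [p]. *)
Definition weighted_design {R : realType} {d : nat} (S : set (d.-tuple R))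
    (mu : set (d.-tuple R) -> \bar R) (t : nat)
    (X : {fset d.-tuple R}) (w : d.-tuple R -> R) : Prop :=
  [/\ [set` X] `<=` S,
      forall x, x \in X -> 0 < w x &
      forall p : mpoly d R, (msize p <= t.+1)%N ->
        (\sum_(x <- X) w x * meval (tnth x) p)%:E =
        (\int[mu]_(x in S) (meval (tnth x) p)%:E)%E].

Definition weighted_spherical_design {R : realType} {d : nat} :=
  weighted_design (unit_sphere d) (@sphere_measure R d).

Definition weighted_gaussian_design {R : realType} {d : nat} :=
  weighted_design setT (@gaussian_measure R d).

(* Main.v *)
Require Import Defs.
From mathcomp Require Import all_boot all_order all_algebra finmap.
From mathcomp Require mpoly.
Import -(notations) mpoly.
From mathcomp Require Import all_classical all_reals all_analysis.
From mathcomp Require Import measurable_realfun measurable_fun_approximation.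
From mathcomp Require Import ring lra.
From mathcomp Require Import polyrcf.

Set Implicit Arguments.
Unset Strict Implicit.
Unset Printing Implicit Defensive.

Import Order.TTheory GRing.Theory Num.Theory.
Import numFieldNormedType.Exports.

Local Open Scope classical_set_scope.
Local Open Scope ring_scope.

(** Write [c_k] for the integral of [|x|^k] against the Gaussian measure [rho].
    In polar coordinates the radial and the angular variables separate, so a
    homogeneous function [f] of degree [k] satisfies
      [\int f d rho = c_k * \int_S f d mu]
    with [mu] the normalized surface measure of the sphere [S]
    ([ge0_gaussian_homogeneous], [gaussian_homogeneous]).  The [c_k] are the
    moments of a measure on the half-line, namely the law of [|x|]; Gauss
    quadrature ([gauss_quadrature]) provides [t.+1] radii [a > 0] with weights
    [v a > 0] such that [\sum_a v a * a ^+ k = c_k] for all [k <= t].  If the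
    points [x] with weights [w x] form a spherical design, then a monomial [f]
    of degree [k <= t] satisfies
      [\sum_(a, x) v a * w x * f (a x) = (\sum_a v a * a ^+ k) (\sum_x w x * f x)
         = c_k * \int_S f d mu = \int f d rho],
    so the dilates [a x], with weights [v a * w x], form a Gaussian design.

    The separation of variables is proved without a polar change of variables
    theorem, from Tonelli's theorem and the scaling rule
    [\int g(s x) dx = s^-n \int g(x) dx] alone.  Let [h] be constant on
    rays and consider the double integral of [h x * phi |x| * psi |y|].  The
    three successive substitutions [y := |x| y], [x := x / |y|], [y := |x| y]
    turn it into a product in which [psi] is evaluated at [|x|] and the factor
    that contains [phi] depends on [y] alone ([radial_exchange]).  Hence
    [\int h x * phi |x| dx] is, as a function of [phi], proportional to
    [\int phi |x| dx].  Taking for [phi] the indicator of the interval from [0]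
    to [1] identifies the factor, since the surface measure of a set of
    directions is [n] times the volume of the cone that it spans.

    Gauss quadrature rests on one property of the functional [L] that sends
    ['X^k] to [c_k]: it is positive on nonzero polynomials that are nonnegative
    on the half-line ([gaussian_moment_functional_gt0]).  A nonzero polynomial
    of size at most [t.+2] that is [L]-orthogonal to all polynomials of size at
    most [t.+1] then has [t.+1] distinct positive roots, and these are the
    radii. *)

(** * Dilations and Lebesgue measure *)

Section scaling.
Context {R : realType}.
Implicit Types n : nat.

Local Notation leb n := (@lebesgue_rn R n).

(** Both sides are integrals of [f], against Lebesgue measure and against [s]
    times its image by [x |-> s * x]; these measures agree on intervals. *)
Lemma ge0_integral_lebesgue_scale (s : R) (f : measurableTypeR R -> \bar R) :
  0 < s -> measurable_fun setT f -> (forall x, 0 <= f x)%E ->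
  (\int[lebesgue_measure]_x f x = s%:E * \int[lebesgue_measure]_x f (s * x)%R)%E.
Proof.
move=> s0 mf f0.
have ms : measurable_fun setT (fun x : measurableTypeR R => s * x : measurableTypeR R).
  exact: measurable_funM.
pose M : {measure set measurableTypeR R -> \bar R} :=
  measure_function_pushforward__canonical__measure_function_Measure lebesgue_measure ms.
have sE : (0 <= s)%R by exact: ltW.
pose mu := mscale (NngNum sE) M.
rewrite (eq_measure_integral mu); last first.
  move=> A mA _; apply: lebesgue_measure_unique => // _ [[a b] _ <-].
  pose I : set R := `](a / s), (b / s)]%classic.
  transitivity (s%:E * lebesgue_measure I)%E; last first.
    rewrite /I; congr (_ * lebesgue_measure _)%E; apply/seteqP; split => x /=;
      by rewrite !in_itv/= ltr_pdivrMr// ler_pdivlMr// [x * s]mulrC.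
  rewrite /I !lebesgue_measure_itv/= !lte_fin ltr_pM2r ?invr_gt0//.
  case: ifPn => _; last by rewrite mule0.
  by rewrite -!EFinD -!EFinM -mulrBl mulrC divfK// gt_eqF//.
by rewrite ge0_integral_mscale//= ge0_integral_pushforward//.
Qed.

Lemma ge0_integral_lebesgue_rnS n (f : n.+1.-tuple R -> \bar R) :
  measurable_fun setT f -> (forall x, 0 <= f x)%E ->
  (\int[leb n.+1]_x f x =
   \int[lebesgue_measure]_x \int[leb n]_y f (rn_cons (x, y)))%E.
Proof.
move=> mf f0.
rewrite -[leb n.+1]/(pushforward (lebesgue_measure \x leb n)%E (@rn_cons R n)).
rewrite ge0_integral_pushforward//; last exact: measurable_rn_cons.
rewrite preimage_setT fubini_tonelli1//.
- by apply: measurableT_comp => //; exact: measurable_rn_cons.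
- by move=> x; exact: f0.
Qed.

Lemma measurable_scale_rn n (s : R) :
  measurable_fun setT (scale_rn s : n.-tuple R -> n.-tuple R).
Proof.
apply/measurable_fun_tnthP => i /=.
rewrite (_ : _ \o _ = fun x => s * tnth x i); last first.
  by apply/funext => x /=; rewrite tnth_mktuple.
by apply: measurable_funM => //; exact: measurable_tnth.
Qed.

Lemma ge0_integral_scale_rn n (s : R) (f : n.-tuple R -> \bar R) :
  0 < s -> measurable_fun setT f -> (forall x, 0 <= f x)%E ->
  (\int[leb n]_x f x =
   (s ^+ n)%:E * \int[leb n]_x f (scale_rn s x))%E.
Proof.
move=> s0; elim: n f => [|n IH] f mf f0.
  rewrite expr0 mul1e; apply: eq_integral => x _; congr f.
  by rewrite tuple0 [RHS]tuple0.
rewrite !ge0_integral_lebesgue_rnS//; last first.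
  by apply: measurableT_comp => //; exact: measurable_scale_rn.
have mfc : measurable_fun setT (fun z => f (@rn_cons R n z)).
  by apply: measurableT_comp => //; exact: measurable_rn_cons.
under eq_integral => x _.
  rewrite IH//; last first.
    exact: (measurableT_comp mfc).
  over.
have mF : measurable_fun setT (fun x => \int[leb n]_y f (rn_cons (x, scale_rn s y)))%E.
  apply: (@measurable_fun_fubini_tonelli_F _ _ _ _ _ (leb n)
    (fun z => f (rn_cons (z.1, scale_rn s z.2)))) => //.
  apply: (measurableT_comp mfc (g := fun z => (z.1, scale_rn s z.2))).
  by apply: measurable_fun_pair => //; apply: measurableT_comp => //; exact: measurable_scale_rn.
have F0 x : (0 <= \int[leb n]_y f (rn_cons (x, scale_rn s y)))%E.
  exact: integral_ge0.
have sn0 : (0 <= (s ^+ n)%:E)%E by rewrite lee_fin exprn_ge0// ltW.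
rewrite (ge0_integralZl _ measurableT mF (fun x _ => F0 x) sn0).
rewrite (ge0_integral_lebesgue_scale s0 mF F0).
rewrite muleA -EFinM -exprSr.
congr (_ * _)%E.
apply: eq_integral => x _; apply: eq_integral => y _; congr f.
apply: eq_from_tnth => i; rewrite tnth_mktuple.
case: (unliftP ord0 i) => [j|] ->.
  by rewrite /rn_cons !tnthS tnth_mktuple.
by rewrite /rn_cons !tnth0.
Qed.

End scaling.

(** * Separation of the radial and angular variables *)

Section polar.
Context {R : realType} {n : nat}.
Implicit Types (x y : n.-tuple R) (r s : R).

Local Notation leb := (@lebesgue_rn R n).

Lemma norm2_ge0 x : 0 <= norm2 x.
Proof. exact: sqrtr_ge0. Qed.

Lemma norm2_scale r x : 0 <= r -> norm2 (scale_rn r x) = r * norm2 x.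
Proof.
move=> r0; rewrite /norm2; under eq_bigr do rewrite tnth_mktuple exprMn.
by rewrite -mulr_sumr sqrtrM ?sqr_ge0// sqrtr_sqr ger0_norm.
Qed.

Lemma scale_rnA r s x : scale_rn r (scale_rn s x) = scale_rn (r * s) x.
Proof. by apply: eq_from_tnth => i; rewrite !tnth_mktuple mulrA. Qed.

Lemma scale_rn1 x : scale_rn 1 x = x.
Proof. by apply: eq_from_tnth => i; rewrite !tnth_mktuple mul1r. Qed.

Lemma measurable_norm2V : measurable_fun setT (fun x => (norm2 x)^-1).
Proof.
rewrite (_ : (fun _ => _) = fun x => norm2 x `^ (-1)).
  by apply: (measurableT_comp (f := @powR R ^~ (-1))) => //; exact: measurable_norm2.
by apply/funext => x; rewrite powR_inv1 ?norm2_ge0.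
Qed.

Lemma ge0_integral_scale_rn_EFin s (f : n.-tuple R -> R) :
  0 < s -> measurable_fun setT f -> (forall x, 0 <= f x) ->
  (\int[leb]_x (f x)%:E = \int[leb]_x (s ^+ n * f (scale_rn s x))%:E)%E.
Proof.
move=> s0 mf f0; under [RHS]eq_integral do rewrite EFinM.
have mfE : measurable_fun setT (EFin \o f) by exact/measurable_EFinP.
rewrite ge0_integralZl//; last 3 first.
- apply: (measurableT_comp mfE (g := scale_rn s)); exact: measurable_scale_rn.
- by move=> x _; rewrite lee_fin.
- by rewrite lee_fin exprn_ge0// ltW.
by rewrite (ge0_integral_scale_rn s0 mfE).
Qed.

Lemma ge0_integral_mul (f g : n.-tuple R -> R) :
  measurable_fun setT f -> measurable_fun setT g ->
  (forall x, 0 <= f x) -> (forall x, 0 <= g x) ->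
  ((\int[leb]_x (f x)%:E) * (\int[leb]_x (g x)%:E) =
   \int[leb]_x \int[leb]_y (f x * g y)%:E)%E.
Proof.
move=> /measurable_EFinP mf /measurable_EFinP mg f0 g0.
rewrite -ge0_integralZr//; last 2 first.
- by move=> x _; rewrite lee_fin.
- by apply: integral_ge0 => x _; rewrite lee_fin.
apply: eq_integral => x _; rewrite -ge0_integralZl//; last by rewrite lee_fin.
by move=> y _; rewrite lee_fin.
Qed.

Definition radial_integral (h : n.-tuple R -> R) (phi : R -> R) : \bar R :=
  (\int[leb]_x (h x * phi (norm2 x))%:E)%E.

(** Only [h] depends on the direction of [x], and it ends up multiplied by
    [psi], while the factor that contains [phi] no longer depends on [h]: the
    dependence on [phi] of the radial integral is the same for all [h].  The
    profiles vanish at [0] so that the substitutions, which divide by [|x|] and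
    [|y|], may ignore the origin. *)
Lemma radial_exchange (h : n.-tuple R -> R) (phi psi : R -> R) :
  measurable_fun setT h -> measurable_fun setT phi -> measurable_fun setT psi ->
  (forall x, 0 <= h x) -> (forall r, 0 <= phi r) -> (forall r, 0 <= psi r) ->
  (forall s x, 0 < s -> h (scale_rn s x) = h x) ->
  phi 0 = 0 -> psi 0 = 0 ->
  (radial_integral h phi * radial_integral (cst 1%R) psi =
   radial_integral h psi *
     \int[leb]_y (phi (norm2 y)^-1 * (norm2 y)^-1 ^+ (n + n))%:E)%E.
Proof.
move=> mh mphi mpsi h0 phi0 psi0 hh phi00 psi00.
have mN := @measurable_norm2 R n.
have mV := measurable_norm2V.
have V0 x : 0 <= (norm2 x)^-1 by rewrite invr_ge0 norm2_ge0.
have m1 : measurable_fun setT (fst : n.-tuple R * n.-tuple R -> _) by [].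
have m2 : measurable_fun setT (snd : n.-tuple R * n.-tuple R -> _) by [].
have mh1 := measurableT_comp mh m1.
have mN1 := measurableT_comp mN m1.
have mN2 := measurableT_comp mN m2.
have mV1 := measurableT_comp mV m1.
have mV2 := measurableT_comp mV m2.
have mK : measurable_fun setT (fun y => phi (norm2 y)^-1 * (norm2 y)^-1 ^+ (n + n)).
  apply: measurable_funM; last exact: (measurable_funX (f := fun y => (norm2 y)^-1)).
  exact: (measurableT_comp mphi mV).
have K0 y : 0 <= phi (norm2 y)^-1 * (norm2 y)^-1 ^+ (n + n).
  by rewrite mulr_ge0 ?exprn_ge0.
have mr (k : n.-tuple R -> R) (f : R -> R) : measurable_fun setT k ->
    measurable_fun setT f -> measurable_fun setT (fun x => k x * f (norm2 x)).
  by move=> mk mf; apply: measurable_funM => //; exact: (measurableT_comp mf mN).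
have r0 (k : n.-tuple R -> R) (f : R -> R) : (forall x, 0 <= k x) ->
    (forall r, 0 <= f r) -> forall x, 0 <= k x * f (norm2 x).
  by move=> k0 f0 x; rewrite mulr_ge0.
have m1' : measurable_fun setT (cst 1 : n.-tuple R -> R) by exact: measurable_cst.
rewrite /radial_integral.
rewrite (ge0_integral_mul (mr _ _ mh mphi) (mr _ _ m1' mpsi) (r0 _ _ h0 phi0)
  (r0 _ _ (fun=> ler01) psi0)).
rewrite (ge0_integral_mul (mr _ _ mh mpsi) mK (r0 _ _ h0 psi0) K0).
pose F2 (z : n.-tuple R * n.-tuple R) := h z.1 * phi (norm2 z.1) *
  norm2 z.1 ^+ n * psi (norm2 z.1 * norm2 z.2).
pose F3 (z : n.-tuple R * n.-tuple R) := h z.1 * phi (norm2 z.1 * (norm2 z.2)^-1) * norm2 z.1 ^+ n *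
  (norm2 z.2)^-1 ^+ (n + n) * psi (norm2 z.1).
have mF2 : measurable_fun setT F2.
  apply: measurable_funM; last first.
    by apply: measurableT_comp => //; exact: measurable_funM.
  apply: measurable_funM; last exact: measurable_funX.
  by apply: measurable_funM => //; exact: measurableT_comp.
have mF3 : measurable_fun setT F3.
  apply: measurable_funM; last exact: measurableT_comp.
  apply: measurable_funM; last exact: measurable_funX.
  apply: measurable_funM; last exact: measurable_funX.
  apply: measurable_funM => //.
  by apply: measurableT_comp => //; exact: measurable_funM.
have F20 z : (0 <= (F2 z)%:E)%E by rewrite lee_fin !mulr_ge0 ?exprn_ge0 ?norm2_ge0.
have F30 z : (0 <= (F3 z)%:E)%E by rewrite lee_fin !mulr_ge0 ?exprn_ge0 ?norm2_ge0.
have mF2E : measurable_fun setT (EFin \o F2) by exact/measurable_EFinP.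
have mF3E : measurable_fun setT (EFin \o F3) by exact/measurable_EFinP.
(* substitution of [|x| y] for [y] *)
transitivity (\int[leb]_x \int[leb]_y (F2 (x, y))%:E)%E.
  apply: eq_integral => x _.
  have [x0|x0] := eqVneq (norm2 x) 0.
    by apply: eq_integral => y _; rewrite /F2/= x0 phi00 mulr0 !mul0r.
  have xp : 0 < norm2 x by rewrite lt_def x0 norm2_ge0.
  rewrite (@ge0_integral_scale_rn_EFin (norm2 x))//; last 2 first.
  - by apply: measurable_funM => //; apply: measurable_funM => //; exact: measurableT_comp.
  - by move=> y; rewrite !mulr_ge0.
  apply: eq_integral => y _; congr EFin; rewrite /F2/= norm2_scale ?norm2_ge0//.
  by ring.
rewrite (@fubini_tonelli _ _ _ _ R leb leb (EFin \o F2) mF2E F20).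
(* substitution of [x / |y|] for [x] *)
transitivity (\int[leb]_y \int[leb]_x (F3 (x, y))%:E)%E.
  apply: eq_integral => y _.
  have [y0|y0] := eqVneq (norm2 y) 0.
    apply: eq_integral => x _.
    by rewrite /F2 /F3/= y0 invr0 !mulr0 psi00 phi00 !(mulr0, mul0r).
  have yp : 0 < (norm2 y)^-1 by rewrite invr_gt0 lt_def y0 norm2_ge0.
  rewrite (@ge0_integral_scale_rn_EFin (norm2 y)^-1)//; last 2 first.
  - by apply: (measurableT_comp mF2 (g := fun x => (x, y))).
  - by move=> x; rewrite -lee_fin.
  apply: eq_integral => x _; congr EFin; rewrite /F2 /F3/= norm2_scale ?ltW// hh//.
  have -> : (norm2 y)^-1 * norm2 x * norm2 y = norm2 x by rewrite mulrAC mulVf ?mul1r.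
  by rewrite [_^-1 * norm2 x]mulrC exprMn exprD; ring.
(* substitution of [|x| y] for [y] *)
rewrite -(@fubini_tonelli _ _ _ _ R leb leb (EFin \o F3) mF3E F30).
apply: eq_integral => x _.
have [x0|x0] := eqVneq (norm2 x) 0.
  by apply: eq_integral => y _; rewrite /F3/= x0 psi00 !(mulr0, mul0r).
have xp : 0 < norm2 x by rewrite lt_def x0 norm2_ge0.
rewrite (@ge0_integral_scale_rn_EFin (norm2 x) (fun y => F3 (x, y)))//; last 2 first.
- by apply: (measurableT_comp mF3 (g := fun y => (x, y))); exact: measurable_fun_pair.
- by move=> y; rewrite -lee_fin.
apply: eq_integral => y _; congr EFin; rewrite /F3/= norm2_scale ?norm2_ge0//.
have -> : norm2 x / (norm2 x * norm2 y) = (norm2 y)^-1.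
  by rewrite invfM mulrA divff// mul1r.
rewrite invfM exprMn !exprD !exprVn.
have u := divff (expf_neq0 n x0).
transitivity ((norm2 x ^+ n / norm2 x ^+ n) * (norm2 x ^+ n / norm2 x ^+ n) *
  (h x * psi (norm2 x) * (phi (norm2 y)^-1 * ((norm2 y ^+ n)^-1 * (norm2 y ^+ n)^-1)))).
  by ring.
by rewrite u !mul1r.
Qed.

(** The factor of [radial_exchange] that depends on [phi] is found by applying
    it a second time to the constant function [1]. *)
Lemma radial_integral_cross (h : n.-tuple R -> R) (phi psi : R -> R) :
  measurable_fun setT h -> measurable_fun setT phi -> measurable_fun setT psi ->
  (forall x, 0 <= h x) -> (forall r, 0 <= phi r) -> (forall r, 0 <= psi r) ->
  (forall s x, 0 < s -> h (scale_rn s x) = h x) ->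
  phi 0 = 0 -> psi 0 = 0 ->
  (0 < radial_integral (cst 1%R) psi < +oo)%E ->
  (radial_integral h phi * radial_integral (cst 1%R) psi =
   radial_integral h psi * radial_integral (cst 1%R) phi)%E.
Proof.
move=> mh mphi mpsi h0 phi0 psi0 hh phi00 psi00 /andP[psi_gt0 psi_fin].
rewrite radial_exchange//; congr (_ * _)%E.
have := @radial_exchange (cst 1) phi psi _ mphi mpsi (fun=> ler01) phi0 psi0 _ phi00 psi00.
move=> /(_ _ (fun _ _ _ => erefl)) E.
have finpsi : radial_integral (cst 1%R) psi \is a fin_num by rewrite ge0_fin_numE// ltW.
apply/eqP; rewrite eq_le; apply/andP; split;
  by rewrite -(lee_pmul2l finpsi psi_gt0) -E// muleC.
Qed.

End polar.

(** * Integration against the image of a weighted measure *)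

Section weighted_image.
Context d1 d2 (X : measurableType d1) (Y : measurableType d2) (R : realType).
Variables (mu : {measure set X -> \bar R}) (nu : {measure set Y -> \bar R}).
Variables (phi : X -> Y) (g : X -> R).
Hypotheses (mphi : measurable_fun setT phi) (mg : measurable_fun setT g).
Hypothesis g0 : forall x, 0 <= g x.
Hypothesis nuE : forall A, measurable A ->
  nu A = (\int[mu]_x (g x * \1_A (phi x))%:E)%E.

Import HBNNSimple.

Let integral_nnsfun (h : {nnsfun Y >-> R}) :
  (\int[nu]_y (h y)%:E = \int[mu]_x (g x * h (phi x))%:E)%E.
Proof.
have mr r : measurable (h @^-1` [set r]) by exact: measurable_funPTI.
have hE y : (h y)%:E = (\sum_(r \in range h) (r * \1_(h @^-1` [set r]) y)%:E)%E.
  by rewrite fimfunE -fsumEFin.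
under eq_integral do rewrite hE.
rewrite ge0_integral_fsum//; last 2 first.
- by move=> r; exact/measurable_EFinP/measurable_funM.
- by move=> r y _; rewrite nnfun_muleindic_ge0.
have mi r : measurable_fun setT (fun x => g x * \1_(h @^-1` [set r]) (phi x)).
  apply: measurable_funM => //.
  exact: (measurableT_comp (measurable_indic (mr r)) mphi).
transitivity (\int[mu]_x (\sum_(r \in range h)
    (r * (g x * \1_(h @^-1` [set r]) (phi x)))%:E))%E; last first.
  apply: eq_integral => x _; rewrite EFinM hE ge0_mule_fsumr.
    by apply: eq_fsbigr => r _; rewrite -EFinM mulrCA.
  by move=> r; rewrite nnfun_muleindic_ge0.
rewrite ge0_integral_fsum//; last 2 first.
- by move=> r; apply/measurable_EFinP; exact: measurable_funM.
- move=> r x _; rewrite mulrCA EFinM mule_ge0 ?lee_fin//.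
  by rewrite -lee_fin nnfun_muleindic_ge0.
apply: eq_fsbigr => r; rewrite inE => -[y _ <-].
rewrite integralZl_indic_nnsfun//. rewrite integral_indic// setIT nuE//.
under [RHS]eq_integral do rewrite EFinM.
rewrite ge0_integralZl//; first exact/measurable_EFinP.
- by move=> x _; rewrite lee_fin mulr_ge0.
- by rewrite lee_fin.
Qed.

(** Serves both for the surface measure, the image of a weighted Lebesgue
    measure by the projection to the sphere, and for the Gaussian measure, where
    [phi] is the identity and [g] the density. *)
Lemma ge0_integral_weighted_image (f : Y -> R) :
  measurable_fun setT f -> (forall y, 0 <= f y) ->
  (\int[nu]_y (f y)%:E = \int[mu]_x (g x * f (phi x))%:E)%E.
Proof.
move=> /measurable_EFinP mf f0.
pose f_ := nnsfun_approx measurableT mf.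
have f_cvg y : (EFin \o f_ n) y @[n --> \oo] --> (f y)%:E.
  by apply: cvg_nnsfun_approx => // z _; rewrite lee_fin.
transitivity (limn (fun n => \int[nu]_y (f_ n y)%:E))%E.
  rewrite -monotone_convergence//.
  - by apply: eq_integral => y _; apply/esym/cvg_lim => //; exact: f_cvg.
  - by move=> n; exact/measurable_EFinP.
  - by move=> n y _; rewrite lee_fin.
  - by move=> y _ m n mn; rewrite lee_fin; exact/lefP/nd_nnsfun_approx.
under eq_fun do rewrite integral_nnsfun.
rewrite -monotone_convergence//.
- apply: eq_integral => x _; apply/cvg_lim => //.
  under eq_fun do rewrite EFinM.
  by rewrite EFinM; apply: cvgeZl => //; exact: f_cvg.
- move=> n; apply/measurable_EFinP; apply: measurable_funM => //.
  exact: measurableT_comp.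
- by move=> n x _; rewrite lee_fin mulr_ge0.
- move=> x _ m n mn; rewrite lee_fin ler_wpM2l//.
  exact/lefP/nd_nnsfun_approx.
Qed.

End weighted_image.

(** * Surface and Gaussian measures as integrals over the space *)

Section polar_measures.
Context {R : realType} {n : nat}.
Implicit Types (x y : n.-tuple R) (r s : R).

Local Notation leb := (@lebesgue_rn R n).
Local Notation sphere := (@unit_sphere R n).
Local Notation sigma := (@surface_measure R n).
Local Notation rho := (@gaussian_measure R n).

Definition ball_profile : R -> R := \1_(`]0, 1]%classic).

Lemma measurable_ball_profile : measurable_fun setT ball_profile.
Proof. by apply: measurable_indic; exact: measurable_itv. Qed.

Lemma ball_profile_ge0 r : 0 <= ball_profile r.
Proof. by rewrite /ball_profile indicE ler0n. Qed.

Lemma ball_profile0 : ball_profile 0 = 0.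
Proof. by rewrite /ball_profile indicE memNset//= in_itv/= ltxx. Qed.

Definition direction x := scale_rn (norm2 x)^-1 x.

Lemma measurable_direction : measurable_fun setT direction.
Proof.
apply/measurable_fun_tnthP => i /=.
rewrite (_ : _ \o _ = fun x => (norm2 x)^-1 * tnth x i); last first.
  by apply/funext => x /=; rewrite tnth_mktuple.
apply: measurable_funM; first exact: measurable_norm2V.
exact: measurable_tnth.
Qed.

Lemma direction_sphere x : 0 < norm2 x -> sphere (direction x).
Proof.
by move=> x0; rewrite /unit_sphere/= norm2_scale ?invr_ge0 ?ltW// mulVf ?gt_eqF.
Qed.

(** Relates the cone that defines the surface measure to polar coordinates. *)
Lemma cone_sphere_indic (A : set (n.-tuple R)) x :
  \1_(cone (A `&` sphere)) x = ball_profile (norm2 x) * \1_A (direction x) :> R.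
Proof.
rewrite /ball_profile !indicE -natrM mulnb; congr (_ %:R); congr nat_of_bool.
apply/idP/andP; rewrite !inE/= in_itv/=.
- move=> [r /andP[r0 r1] [u [Au Su] ->]]; rewrite /direction.
  rewrite (norm2_scale _ (ltW r0)) Su mulr1 r0 r1; split => //.
  by rewrite scale_rnA mulVf ?gt_eqF// scale_rn1.
- move=> [/andP[x0 x1] Ax]; exists (norm2 x); first by rewrite x0 x1.
  exists (direction x); first by split => //; exact: direction_sphere.
  by rewrite scale_rnA divff ?gt_eqF// scale_rn1.
Qed.

(** The surface measure is the image, by the projection to the sphere, of [n]
    times Lebesgue measure on the punctured unit ball. *)
Lemma ge0_integral_surface (f : n.-tuple R -> R) :
  measurable_fun setT f -> (forall x, 0 <= f x) ->
  (\int[sigma]_(x in sphere) (f x)%:E =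
   \int[leb]_x (n%:R * ball_profile (norm2 x) * f (direction x))%:E)%E.
Proof.
move=> mf f0.
have mS := @measurable_unit_sphere R n.
have mB : measurable_fun setT (fun x => ball_profile (norm2 x)).
  exact: (measurableT_comp measurable_ball_profile (@measurable_norm2 R n)).
rewrite integral_mkcond.
transitivity (\int[sigma]_x (f x * \1_sphere x)%:E)%E.
  by apply: eq_integral => x _; rewrite epatch_indic.
rewrite (@ge0_integral_weighted_image _ _ _ _ R leb sigma direction
  (fun x => n%:R * ball_profile (norm2 x))) //.
- apply: eq_integral => x _; congr EFin.
  have [->|x0] := eqVneq (norm2 x) 0; first by rewrite ball_profile0 !(mulr0, mul0r).
  rewrite !indicE mem_set ?mulr1//; apply: direction_sphere.
  by rewrite lt_def x0 norm2_ge0.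
- exact: measurable_direction.
- exact: measurable_funM.
- by move=> x; rewrite mulr_ge0// ball_profile_ge0.
- move=> A mA; rewrite /surface_measure.
  under eq_integral do rewrite -mulrA -cone_sphere_indic EFinM.
  have mC := measurable_cone mA.
  rewrite ge0_integralZl//.
  + by rewrite integral_indic// setIT.
  + exact/measurable_EFinP/measurable_indic.
- by apply: measurable_funM => //; exact: measurable_indic.
- by move=> x; rewrite mulr_ge0.
Qed.

Definition gauss_profile r : R := expR (- pi * r ^+ 2).

Lemma measurable_gauss_profile : measurable_fun setT gauss_profile.
Proof.
by apply: measurableT_comp => //; apply: measurable_funM => //; exact: measurable_funX.
Qed.

Lemma ge0_integral_gaussian (f : n.-tuple R -> R) :
  measurable_fun setT f -> (forall x, 0 <= f x) ->
  (\int[rho]_x (f x)%:E = \int[leb]_x (gauss_profile (norm2 x) * f x)%:E)%E.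
Proof.
move=> mf f0.
rewrite (@ge0_integral_weighted_image _ _ _ _ R leb rho id
  (fun x => gauss_profile (norm2 x))) //.
- exact: (measurableT_comp measurable_gauss_profile (@measurable_norm2 R n)).
- by move=> x; exact: expR_ge0.
- move=> A mA; rewrite /gaussian_measure [LHS]integral_mkcond.
  by apply: eq_integral => x _; rewrite epatch_indic.
Qed.

End polar_measures.

Section origin.
Context {R : realType}.

(** The origin is negligible, because it lies in the hyperplane where the first
    coordinate vanishes. *)
Lemma lebesgue_rn_norm2_eq0 n : (0 < n)%N ->
  lebesgue_rn [set x : n.-tuple R | norm2 x = 0] = 0%E.
Proof.
case: n => // n _.
have m0 : measurable [set x : n.+1.-tuple R | norm2 x = 0].
  rewrite (_ : [set _ | _] = norm2 @^-1` [set 0])//.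
  by rewrite -[X in measurable X]setTI; exact: measurable_norm2.
rewrite -[LHS]/((lebesgue_measure \x @lebesgue_rn R n)%E (@rn_cons R n @^-1` _)).
apply/eqP; rewrite eq_le measure_ge0 andbT.
apply: (@le_trans _ _ ((lebesgue_measure \x @lebesgue_rn R n)%E ([set 0] `*` setT))).
  apply: le_measure; rewrite ?inE//.
  - rewrite -[X in measurable X]setTI; exact: measurable_rn_cons.
  - exact: measurableX.
  move=> [x y]/= /eqP; rewrite sqrtr_eq0 big_ord_recl /rn_cons tnth0/= => s0.
  split => //; apply/eqP; rewrite -sqrf_eq0 eq_le sqr_ge0 andbT.
  apply: le_trans s0; rewrite lerDl sumr_ge0// => i _; exact: sqr_ge0.
by rewrite product_measure1E//= lebesgue_measure_set1 mul0e.
Qed.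

Lemma ge0_eq_integral_lebesgue_rn n (f g : n.-tuple R -> R) : (0 < n)%N ->
  measurable_fun setT f -> measurable_fun setT g ->
  (forall x, 0 <= f x) -> (forall x, 0 <= g x) ->
  (forall x, 0 < norm2 x -> f x = g x) ->
  (\int[@lebesgue_rn R n]_x (f x)%:E = \int[@lebesgue_rn R n]_x (g x)%:E)%E.
Proof.
move=> n0 /measurable_EFinP mf /measurable_EFinP mg f0 g0 fg.
apply: ge0_ae_eq_integral => //.
- by move=> x _; rewrite lee_fin.
- by move=> x _; rewrite lee_fin.
exists [set x | norm2 x = 0]; split.
- rewrite (_ : [set _ | _] = norm2 @^-1` [set 0])//.
  by rewrite -[X in measurable X]setTI; exact: measurable_norm2.
- exact: lebesgue_rn_norm2_eq0.
- move=> x /=; apply: contra_notP => /eqP x0 _; rewrite fg//.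
  by rewrite lt_def x0 norm2_ge0.
Qed.

End origin.

(** * Finiteness of the Gaussian moments *)

Section moments.
Context {R : realType}.
Implicit Types n k : nat.

Lemma norm2_rn_cons n (x : R) (y : n.-tuple R) :
  norm2 (rn_cons (x, y)) ^+ 2 = x ^+ 2 + norm2 y ^+ 2.
Proof.
rewrite /norm2 !sqr_sqrtr ?sumr_ge0//; try by move=> i _; exact: sqr_ge0.
rewrite big_ord_recl /rn_cons tnth0; congr (_ + _).
by apply: eq_bigr => i _; rewrite tnthS.
Qed.

Lemma measurable_gauss_norm2 n :
  measurable_fun setT (fun x : n.-tuple R => expR (- norm2 x ^+ 2)).
Proof.
apply: measurableT_comp => //; apply: measurableT_comp => //.
by apply: measurable_funX; exact: measurable_norm2.
Qed.

(** The integrand is a product over the coordinates, which reduces the claim to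
    the one-dimensional Gauss integral. *)
Lemma integral_gauss_norm2_lty n :
  (\int[@lebesgue_rn R n]_x (expR (- norm2 x ^+ 2))%:E < +oo)%E.
Proof.
elim: n => [|n IH].
  have mg := @measurable_gauss_norm2 0.
  rewrite -[@lebesgue_rn R 0]/(\d_([tuple] : 0.-tuple R)) integral_dirac//; last first.
    exact/measurable_EFinP.
  by rewrite diracT mul1e ltry.
rewrite ge0_integral_lebesgue_rnS//; last first.
  by apply/measurable_EFinP; exact: measurable_gauss_norm2.
under eq_integral => x _.
  under eq_integral do rewrite norm2_rn_cons opprD expRD EFinM.
  rewrite ge0_integralZl//; last first.
    by apply/measurable_EFinP; exact: measurable_gauss_norm2.
  over.
rewrite ge0_integralZr//; last 2 first.
- by apply/measurable_EFinP; exact: measurable_gauss_fun.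
- exact: integral_ge0.
have -> : (\int[lebesgue_measure]_x (expR (- x ^+ 2))%:E = (Num.sqrt (@pi R))%:E)%E.
  by rewrite -integralT_gauss.
by rewrite lte_mul_pinfty// ?lee_fin ?sqrtr_ge0.
Qed.

(** Since [2 <= pi], half of the exponential decay is left to absorb the power
    of [r], through [x ^+ k <= k`! * expR x]. *)
Lemma gauss_profile_exprn_le k (r : R) : 0 <= r ->
  gauss_profile r * r ^+ k <= (1 + k`!%:R) * expR (- r ^+ 2).
Proof.
move=> r0.
have r20 : 0 <= r ^+ 2 by exact: sqr_ge0.
have gE : gauss_profile r <= expR (- r ^+ 2) * expR (- r ^+ 2).
  rewrite -expRD ler_expR mulNr -opprD lerN2 -mulr2n -mulr_natl.
  by rewrite ler_wpM2r// pi_ge2.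
(* [u <= 1 + u ^+ 2] for [u := r ^+ k] *)
have h1 : r ^+ k <= 1 + (r ^+ 2) ^+ k.
  rewrite -exprM mulnC exprM; have := sqr_ge0 (r ^+ k - 1); have := exprn_ge0 k r0.
  nra.
have h2 : (r ^+ 2) ^+ k <= k`!%:R * expR (r ^+ 2).
  case: k {h1} => [|k]; first by rewrite expr0 fact0 mul1r -expR0 ler_expR.
  rewrite mulrC -ler_pdivrMr ?ltr0n ?fact_gt0//.
  by apply: le_trans (expR_ge1Dxn k r20); rewrite lerDr.
have e1 : 1 <= expR (r ^+ 2) by rewrite -expR0 ler_expR.
have e0 := expR_ge0 (- r ^+ 2).
apply: (@le_trans _ _ (expR (- r ^+ 2) * expR (- r ^+ 2) *
    ((1 + k`!%:R) * expR (r ^+ 2)))).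
  apply: ler_pM => //; first exact: expR_ge0.
    exact: exprn_ge0.
  by rewrite mulrDl mul1r; lra.
rewrite mulrACA [_ * (1 + _)]mulrC -mulrA -expRD addNr expR0 mulr1.
by rewrite mulrC.
Qed.

Lemma gaussian_moment_lty n k :
  (\int[@gaussian_measure R n]_x (norm2 x ^+ k)%:E < +oo)%E.
Proof.
rewrite ge0_integral_gaussian; last 2 first.
- by apply: measurable_funX; exact: measurable_norm2.
- by move=> x; rewrite exprn_ge0 ?norm2_ge0.
apply: (@le_lt_trans _ _ (\int[@lebesgue_rn R n]_x
    ((1 + k`!%:R)%:E * (expR (- norm2 x ^+ 2))%:E))%E).
  apply: ge0_le_integral => //.
  - by move=> x _; rewrite lee_fin mulr_ge0 ?expR_ge0// exprn_ge0 ?norm2_ge0.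
  - apply/measurable_EFinP/measurable_funM.
      exact: (measurableT_comp measurable_gauss_profile (@measurable_norm2 R n)).
    by apply: measurable_funX; exact: measurable_norm2.
  - apply: measurable_funeM.
    by apply/measurable_EFinP; exact: measurable_gauss_norm2.
  - by move=> x _; rewrite -EFinM lee_fin gauss_profile_exprn_le ?norm2_ge0.
rewrite ge0_integralZl//.
- by rewrite lte_mul_pinfty ?lee_fin ?addr_ge0 ?integral_gauss_norm2_lty.
- by apply/measurable_EFinP; exact: measurable_gauss_norm2.
Qed.

End moments.

(** * Polynomials on the half-line and Gauss quadrature *)

Section positive_polynomials.
Variable R : rcfType.
Implicit Types (p : {poly R}) (x : R).

Lemma horner0_ge0 p : (forall x, 0 < x -> 0 <= p.[x]) -> 0 <= p.[0].
Proof.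
move=> p_ge0; rewrite leNgt; apply/negP => p0.
have [|d d0 /(_ (d / 2))] := @poly_cont R 0 p (- p.[0]); first by rewrite oppr_gt0.
have d2 : d / 2 < d by lra.
have pd := p_ge0 _ (divr_gt0 d0 (ltr0n R 2)).
rewrite subr0 gtr0_norm ?divr_gt0// => /(_ d2).
by rewrite ger0_norm; [lra|rewrite subr_ge0 ltW// (lt_le_trans p0)].
Qed.

Lemma no_small_root p : p != 0 ->
  exists2 b, 0 < b & forall x, 0 < x <= b -> ~~ root p x.
Proof.
have [m] := ubnP (size p); elim: m => // m IH in p *; rewrite ltnS => sp p0.
have [[a a0 /factor_theorem[q pq]]|no_root] :=
    pselect (exists2 a, 0 < a & root p a); last first.
  by exists 1 => // x /andP[x0 _]; apply/negP => rx; apply: no_root; exists x.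
have q0 : q != 0 by apply: contra_neq p0 => q0; rewrite pq q0 mul0r.
have [|b b0 bP] := IH q _ q0.
  by apply: leq_trans sp; rewrite pq size_Mmonic ?monicXsubC// size_XsubC addn2.
exists (Num.min b (a / 2)); first by rewrite lt_min b0 divr_gt0.
move=> x; rewrite le_min => /andP[x0 /andP[xb xa]].
rewrite pq rootM negb_or bP ?x0// root_XsubC lt_eqF//.
by apply: le_lt_trans xa _; rewrite ltr_pdivrMr// ltr_pMr// ltr1n.
Qed.

End positive_polynomials.

Section gauss_quadrature.
Variable R : rcfType.
Implicit Types (p q : {poly R}) (s : seq R) (x a : R).

Lemma constant_sign p : (forall x, 0 < x -> ~~ root p x) ->
  exists b : bool, forall x, 0 < x -> 0 <= (-1) ^+ b * p.[x].
Proof.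
move=> no_root; exists (p.[1] < 0) => x x0.
rewrite leNgt; apply/negP => neg.
have sgn y : 0 < y -> p.[y] != 0 by move=> /no_root.
have prod_lt0 : p.[1] * p.[x] < 0.
  move: neg (sgn _ ltr01); case: (ltrgt0P p.[1]) => // p1 neg _.
    by rewrite pmulr_rlt0//; move: neg; rewrite expr0 mul1r.
  by rewrite nmulr_rlt0//; move: neg; rewrite expr1 mulN1r oppr_lt0.
have [x1|x1] := leP 1 x.
  have [y] := poly_ivtoo x1 prod_lt0; rewrite in_itv/= => /andP[y1 _].
  by apply/negP/no_root/(lt_trans ltr01).
rewrite mulrC in prod_lt0.
have [y] := poly_ivtoo (ltW x1) prod_lt0; rewrite in_itv/= => /andP[yx _].
by apply/negP/no_root/(lt_trans x0).
Qed.

(** For [s] one takes the positive roots of odd multiplicity.  By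
    induction on the degree: when a root [a] is split off from [p], it is added
    to the list of the quotient if absent and removed from it if present, so the
    product is multiplied by the square of ['X - a%:P] or left unchanged. *)
Lemma positive_sign_changes p : p != 0 ->
  exists s, exists b : bool, [/\ uniq s, {in s, forall a, 0 < a /\ root p a} &
    forall x, 0 < x -> 0 <= (-1) ^+ b * (p * \prod_(a <- s) ('X - a%:P)).[x]].
Proof.
have [m] := ubnP (size p); elim: m => // m IH in p *; rewrite ltnS => sp p0.
have [[a a0 /[dup] ra /factor_theorem[q pq]]|no_root] :=
    pselect (exists2 a, 0 < a & root p a); last first.
  have [|b bP] := @constant_sign p.
    by move=> x x0; apply/negP => rx; apply: no_root; exists x.
  by exists [::], b; split => // x /bP; rewrite big_nil mulr1.
have q0 : q != 0 by apply: contra_neq p0 => q0; rewrite pq q0 mul0r.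
have [|s [b [us sP bP]]] := IH q _ q0.
  by apply: leq_trans sp; rewrite pq size_Mmonic ?monicXsubC// size_XsubC addn2.
have rpq x : root q x -> root p x by rewrite pq rootM => ->.
have [as_|as_] := boolP (a \in s).
  exists (rem a s), b; split => [|x /mem_rem/sP[x0 /rpq]//|x x0].
    exact: rem_uniq.
  rewrite pq -mulrA; have := bP x x0; rewrite (big_rem a)//=.
exists (a :: s), b; split => [/=||x x0]; first by rewrite as_.
  by move=> x; rewrite inE => /predU1P[->//|/sP[x0 /rpq]].
pose S : {poly R} := \prod_(c <- s) ('X - c%:P).
suff -> : (-1) ^+ b * (p * (\prod_(c <- a :: s) ('X - c%:P))).[x] =
    (x - a) ^+ 2 * ((-1) ^+ b * (q * S).[x]) by rewrite mulr_ge0 ?sqr_ge0 ?bP.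
by rewrite big_cons -/S pq !hornerM hornerXsubC; ring.
Qed.

Variables (c : nat -> R) (n : nat).

(** Truncated at a fixed degree, high enough for the products of two
    polynomials of degree at most [n], so that linearity is immediate. *)
Definition moment_functional p := \sum_(i < n.*2.+1) p`_i * c i.
Local Notation L := moment_functional.

Lemma moment_functionalD p q : L (p + q) = L p + L q.
Proof. by rewrite -big_split; apply: eq_bigr => i _; rewrite coefD mulrDl. Qed.

Lemma moment_functionalZ a p : L (a *: p) = a * L p.
Proof. by rewrite mulr_sumr; apply: eq_bigr => i _; rewrite coefZ mulrA. Qed.

Lemma moment_functional0 : L 0 = 0.
Proof. by apply: big1 => i _; rewrite coef0 mul0r. Qed.

Lemma moment_functional_sum (I : Type) (r : seq I) (F : I -> {poly R}) :
  L (\sum_(i <- r) F i) = \sum_(i <- r) L (F i).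
Proof. exact: (big_morph L moment_functionalD moment_functional0). Qed.

Lemma moment_functionalXn k : (k <= n.*2)%N -> L 'X^k = c k.
Proof.
move=> kn; rewrite /L (bigD1 (Ordinal (kn : (k < n.*2.+1)%N)))//= coefXn eqxx mul1r.
rewrite big1 ?addr0// => i ik; rewrite coefXn (_ : _ == _ = false) ?mul0r//.
by apply: contraNF ik => /eqP ik; apply/eqP/val_inj.
Qed.

Hypothesis c_pos : forall p, p != 0 -> (forall x, 0 < x -> 0 <= p.[x]) ->
  0 < \sum_(i < size p) p`_i * c i.

Lemma moment_functional_gt0 p : (size p <= n.*2.+1)%N -> p != 0 ->
  (forall x, 0 < x -> 0 <= p.[x]) -> 0 < L p.
Proof.
move=> sp p0 /(c_pos p0); rewrite /L -!(big_mkord xpredT (fun i => p`_i * c i)).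
rewrite [in X in _ -> X](big_cat_nat (leq0n _) sp)/= [X in _ + X]big_nat_cond.
rewrite [X in _ + X]big1 ?addr0// => i /andP[/andP[pi _] _].
by rewrite nth_default ?mul0r.
Qed.

(** The orthogonality conditions are [n] linear equations in the [n.+1]
    coefficients of [p]. *)
Lemma exists_orthogonal : exists p, [/\ p != 0, (size p <= n.+1)%N &
  forall q, (size q <= n)%N -> L (p * q) = 0].
Proof.
pose H : 'M[R]_(n.+1, n) := \matrix_(i, j) c (i + j).
have : kermx H != 0.
  rewrite kermx_eq0 /row_free neq_ltn (leq_ltn_trans (rank_leq_col H))//.
case/rowV0Pn => u /sub_kermxP uH u0.
exists (rVpoly u); split.
- by apply: contra_neq u0 => u0; apply: (can_inj rVpolyK); rewrite u0 linear0.
- exact: size_poly.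
- move=> q sq; rewrite -[q]coefK poly_def mulr_sumr moment_functional_sum big1_seq//.
  move=> j _; rewrite -scalerAr moment_functionalZ.
  have jn : (j < n)%N by exact: leq_trans (ltn_ord j) sq.
  suff -> : L (rVpoly u * 'X^j) = 0 by rewrite mulr0.
  rewrite /rVpoly poly_def mulr_suml moment_functional_sum.
  transitivity ((u *m H) 0 (Ordinal jn)); last by rewrite uH mxE.
  rewrite mxE; apply: eq_bigr => i _; rewrite insubT//= => ilt.
  rewrite -scalerAl -exprD moment_functionalZ moment_functionalXn; last first.
    by rewrite -addnn leq_add// -ltnS// ltnW.
  by rewrite !mxE; congr (u _ _ * _); exact: val_inj.
Qed.

(** If the orthogonal polynomial changed sign at fewer than [n] positive points
    [s], then its product with [\prod_(a <- s) ('X - a%:P)] would have constant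
    sign on the half-line, hence a nonzero image by [L], against orthogonality. *)
Lemma exists_gauss_nodes : exists s, [/\ uniq s, size s = n, {in s, forall a, 0 < a} &
  forall q, (size q <= n)%N -> L (\prod_(a <- s) ('X - a%:P) * q) = 0].
Proof.
have [p [p0 sp pL]] := exists_orthogonal.
have [s [b [us sP bP]]] := positive_sign_changes p0.
have rs : all (root p) s by apply/allP => a /sP[].
have size_le : (size s <= n)%N.
  by rewrite -ltnS (leq_trans _ sp)// max_poly_roots.
set W := \prod_(a <- s) ('X - a%:P).
have W0 : W != 0 by rewrite monic_neq0// monic_prod_XsubC.
have size_s : size s = n.
  apply/eqP; rewrite eqn_leq size_le leqNgt; apply/negP => sn.
  have sW : (size W <= n)%N by rewrite size_prod_XsubC.
  have : 0 < L ((-1) ^+ b *: (p * W)).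
    apply: moment_functional_gt0.
    - rewrite size_scale ?signr_eq0// (leq_trans (size_polyMleq _ _))//.
      by rewrite (leq_trans (leq_pred _))// (leq_trans (leq_add sp sW))// addSn addnn.
    - by rewrite scaler_eq0 signr_eq0 mulf_neq0.
    - by move=> x x0; rewrite hornerZ bP.
  by rewrite moment_functionalZ pL// mulr0 ltxx.
have size_p : size p = (size s).+1.
  by apply/eqP; rewrite eqn_leq size_s sp -size_s max_poly_roots.
exists s; split=> // [a /sP[]//|q sq].
have pW : p = lead_coef p *: W.
  by apply: all_roots_prod_XsubC => //; rewrite uniq_rootsE.
have := pL _ sq; rewrite pW -scalerAl moment_functionalZ => /eqP.
by rewrite mulf_eq0 lead_coef_eq0 (negPf p0)/= => /eqP.
Qed.

(** The weight at a node [a] is the image by [L] of the Lagrange polynomial [l a],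
    so exactness is Lagrange interpolation.  The weights are positive because
    [L (l a) = L (l a ^+ 2)]: the difference of the two polynomials is the
    product of the node polynomial and a polynomial of degree less than [n],
    which [L] kills. *)
Theorem gauss_quadrature : exists s (v : R -> R),
  [/\ uniq s, size s = n, {in s, forall a, 0 < a /\ 0 < v a} &
    forall k, (k < n)%N -> \sum_(a <- s) v a * a ^+ k = c k].
Proof.
have [s [us ss s0 sL]] := exists_gauss_nodes.
pose D a := \prod_(b <- rem a s) ('X - b%:P).
have WE a : a \in s -> \prod_(b <- s) ('X - b%:P) = ('X - a%:P) * D a.
  by move=> as_; rewrite (big_rem a).
have sD a : a \in s -> size (D a) = n.
  by move=> as_; rewrite size_prod_XsubC size_rem// ss prednK// -ss; case: s as_ {us ss s0 sL D WE}.
have Da a : a \in s -> (D a).[a] != 0.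
  by move=> as_; rewrite -[_ == 0]/(root _ _) root_prod_XsubC mem_rem_uniq// inE eqxx.
pose l a := (D a).[a]^-1 *: D a.
have sl a : a \in s -> size (l a) = n.
  by move=> as_; rewrite size_scale ?sD// invr_eq0 Da.
have laa a : a \in s -> (l a).[a] = 1 by move=> as_; rewrite hornerZ mulVf ?Da.
have lab a b : a \in s -> b \in s -> a != b -> (l a).[b] = 0.
  move=> as_ bs ab; rewrite hornerZ; apply/eqP; rewrite mulf_eq0; apply/orP; right.
  by rewrite -[_ == 0]/(root _ _) root_prod_XsubC mem_rem_uniq// inE eq_sym ab.
exists s, (fun a => L (l a)); split => //.
- move=> a as_; split; first exact: s0.
  have n0 : (0 < n)%N by rewrite -ss; case: s as_ {us ss s0 sL D WE sD Da l sl laa lab}.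
  have /factor_theorem[r rE] : root (l a - 1) a.
    by rewrite /root hornerD hornerN laa// -polyC1 hornerC subrr.
  have l0 : l a != 0 by rewrite -size_poly_gt0 sl.
  have sr : (size r <= n)%N.
    have [->|r0] := eqVneq r 0; first by rewrite size_poly0.
    have : (size (l a - 1)%R <= n)%N.
      by rewrite (leq_trans (size_polyD _ _))// size_polyN geq_max sl// leqnn size_poly1.
    by rewrite rE size_Mmonic ?monicXsubC// size_XsubC addn2 => /ltnW.
  suff -> : L (l a) = L (l a * l a).
    apply: moment_functional_gt0; last by move=> x _; rewrite hornerM -expr2 sqr_ge0.
      rewrite (leq_trans (size_polyMleq _ _))// sl// addnn.
      by rewrite (leq_trans (leq_pred _)).
    by rewrite mulf_neq0.
  have -> : l a * l a = (l a - 1) * l a + l a by rewrite mulrBl mul1r subrK.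
  rewrite moment_functionalD rE.
  suff -> : L (r * ('X - a%:P) * (l a)) = 0 by rewrite add0r.
  by rewrite /l -scalerAr moment_functionalZ -mulrA -WE// [r * _]mulrC sL// mulr0.
- move=> k kn.
  have <- : L 'X^k = c k.
    by rewrite moment_functionalXn// -addnn (leq_trans (ltnW kn))// leq_addr.
  suff E : 'X^k = \sum_(a <- s) a ^+ k *: l a.
    rewrite [in RHS]E moment_functional_sum.
    by apply: eq_bigr => a _; rewrite (moment_functionalZ (a ^+ k) (l a)) mulrC.
  apply/eqP; rewrite -subr_eq0; apply/eqP; apply: (@roots_geq_poly_eq0 _ _ s) => //.
  + apply/allP => b bs; rewrite /root !hornerE horner_sum (bigD1_seq b)//=.
    rewrite hornerZ laa// mulr1 big1_seq ?addr0 ?subrr// => a /andP[ab as_].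
    by rewrite hornerZ lab// mulr0.
  + rewrite ss (leq_trans (size_polyD _ _))// size_polyN geq_max size_polyXn kn/=.
    rewrite (leq_trans (size_sum _ _ _))//.
    apply/bigmax_leqP_seq => a as_ _.
    by rewrite (leq_trans (size_scale_leq _ _))// sl.
Qed.

End gauss_quadrature.

(** * Homogeneous functions *)

Section homogeneous.
Context {R : realType} {n : nat}.
Implicit Types (x : n.-tuple R) (k : nat) (f : n.-tuple R -> R).

Local Notation leb := (@lebesgue_rn R n).
Local Notation sphere := (@unit_sphere R n).
Local Notation sigma := (@surface_measure R n).
Local Notation mu := (@sphere_measure R n).
Local Notation rho := (@gaussian_measure R n).

Local Notation one := (@cst (n.-tuple R) R 1%R).

Definition homogeneous k f := forall s x, 0 < s -> f (scale_rn s x) = s ^+ k * f x.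

(** The indicator removes the origin, where [gauss_profile] and [r ^+ 0] do not
    vanish, as [radial_exchange] requires. *)
Definition moment_profile k (r : R) : R :=
  r ^+ k * gauss_profile r * \1_(`]0, +oo[%classic) r.

Lemma measurable_moment_profile k : measurable_fun setT (moment_profile k).
Proof.
apply: measurable_funM; last by apply: measurable_indic; exact: measurable_itv.
by apply: measurable_funM; [exact: measurable_funX|exact: measurable_gauss_profile].
Qed.

Lemma moment_profile_ge0 k r : 0 <= moment_profile k r.
Proof.
rewrite /moment_profile indicE; have [|] := boolP (_ \in _); last by rewrite mulr0.
by rewrite inE/= in_itv/= andbT => r0; rewrite mulr1 mulr_ge0 ?expR_ge0 ?exprn_ge0 ?ltW.
Qed.

Lemma moment_profile0 k : moment_profile k 0 = 0.
Proof. by rewrite /moment_profile indicE memNset ?mulr0//= in_itv/= ltxx. Qed.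

(** On the sphere [f] agrees with its radially constant version
    [f x / |x| ^+ k]. *)
Lemma surface_homogeneous k f : measurable_fun setT f -> (forall x, 0 <= f x) ->
  homogeneous k f ->
  (\int[sigma]_(x in sphere) (f x)%:E =
   n%:R%:E * radial_integral (fun x => f x * (norm2 x)^-1 ^+ k)%R ball_profile)%E.
Proof.
move=> mf f0 fk; rewrite ge0_integral_surface// /radial_integral.
under eq_integral do rewrite -mulrA EFinM.
have mB : measurable_fun setT (fun x => ball_profile (norm2 x)).
  exact: (measurableT_comp measurable_ball_profile (@measurable_norm2 R n)).
rewrite ge0_integralZl//; last 2 first.
- apply/measurable_EFinP/measurable_funM => //.
  exact: (measurableT_comp mf measurable_direction).
- by move=> x _; rewrite lee_fin mulr_ge0// ball_profile_ge0.
congr (_ * _)%E; apply: eq_integral => x _; congr EFin.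
have [->|x0] := eqVneq (norm2 x) 0; first by rewrite ball_profile0 mul0r mulr0.
rewrite /direction fk; first by rewrite mulrC; congr (_ * _); rewrite mulrC.
by rewrite invr_gt0 lt_def x0 norm2_ge0.
Qed.

Lemma gaussian_homogeneous_radial k f : (0 < n)%N ->
  measurable_fun setT f -> (forall x, 0 <= f x) ->
  (\int[rho]_x (f x)%:E =
   radial_integral (fun x => f x * (norm2 x)^-1 ^+ k)%R (@moment_profile k))%E.
Proof.
move=> n0 mf f0; rewrite ge0_integral_gaussian// /radial_integral.
apply: ge0_eq_integral_lebesgue_rn => //.
- apply: measurable_funM => //.
  exact: (measurableT_comp measurable_gauss_profile (@measurable_norm2 R n)).
- apply: measurable_funM.
    apply: measurable_funM => //; apply: (measurable_funX (f := fun x => (norm2 x)^-1)).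
    exact: measurable_norm2V.
  exact: (measurableT_comp (@measurable_moment_profile k) (@measurable_norm2 R n)).
- by move=> x; rewrite mulr_ge0// expR_ge0.
- move=> x; apply: mulr_ge0; last exact: moment_profile_ge0.
  by rewrite mulr_ge0// exprn_ge0// invr_ge0 norm2_ge0.
- move=> x x0; rewrite /moment_profile indicE mem_set/= ?in_itv/= ?x0// mulr1 mulrA.
  rewrite -[f x * _ * _]mulrA exprVn mulVf ?mulr1 1?mulrC//.
  by rewrite expf_neq0// gt_eqF.
Qed.

Hypothesis sphere_gt0 : (0 < sigma sphere)%E.
Hypothesis sphere_lty : (sigma sphere < +oo)%E.

Lemma surface_ballE :
  (sigma sphere = n%:R%:E * radial_integral one (@ball_profile R) :> \bar R)%E.
Proof.
transitivity (\int[sigma]_(x in sphere) (one x)%:E)%E.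
  by rewrite -[LHS]mul1e -(integral_cst sigma (@measurable_unit_sphere R n)).
rewrite (@surface_homogeneous 0%N one)//; last by move=> s x _; rewrite expr0 mul1r.
by congr (_ * _)%E; apply: eq_integral => x _; rewrite expr0 mulr1.
Qed.

(** In dimension [0] the surface measure, defined with a factor equal to the
    dimension, is zero. *)
Lemma dim_gt0 : (0 < n)%N.
Proof.
rewrite lt0n; apply/eqP => n0; move: sphere_gt0.
by rewrite surface_ballE n0 mul0e ltxx.
Qed.

Lemma radial_integral_ball_gt0_lty :
  (0 < radial_integral one (@ball_profile R) < +oo)%E.
Proof.
have n0 : (0 < n%:R :> R) by rewrite ltr0n dim_gt0.
move: sphere_gt0 sphere_lty; rewrite surface_ballE => s0 soo.
apply/andP; split.
  by move: s0; rewrite pmule_rgt0 ?lte_fin.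
move: soo; case: (radial_integral _ _) => [b _||]; rewrite ?ltry//.
by rewrite gt0_muley ?lte_fin.
Qed.

(** This is [radial_integral_cross] for [h x = f x / |x| ^+ k], with the profiles
    of the Gaussian moment of order [k] and of the unit ball.  The integrals of the
    second profile against [h] and [1] are, up to the factor [n], the integral of
    [f] over the sphere and the area of the sphere. *)
Lemma ge0_gaussian_homogeneous k f : measurable_fun setT f -> (forall x, 0 <= f x) ->
  homogeneous k f ->
  (\int[rho]_x (f x)%:E =
   (\int[rho]_x (norm2 x ^+ k)%:E) * \int[mu]_(x in sphere) (f x)%:E)%E.
Proof.
move=> mf f0 fk.
have n0 := dim_gt0.
have mN : measurable_fun setT (fun x => norm2 x ^+ k).
  by apply: measurable_funX; exact: measurable_norm2.
have N0 x : 0 <= norm2 x ^+ k by rewrite exprn_ge0 ?norm2_ge0.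
rewrite (gaussian_homogeneous_radial k)//.
rewrite (gaussian_homogeneous_radial k (f := fun x => norm2 x ^+ k))//.
have -> : (radial_integral (fun x => norm2 x ^+ k * (norm2 x)^-1 ^+ k) (@moment_profile k) =
    radial_integral one (@moment_profile k))%R.
  apply: eq_integral => x _; congr EFin.
  have [->|x0] := eqVneq (norm2 x) 0; first by rewrite moment_profile0 !mulr0.
  by rewrite exprVn divff// expf_neq0.
have mS := @measurable_unit_sphere R n.
rewrite /sphere_measure ge0_integral_mscale//=; last 2 first.
- by apply/measurable_EFinP; exact: measurable_funTS.
- by move=> x _; rewrite lee_fin.
rewrite (surface_homogeneous (k := k))// surface_ballE.
have /andP[] := radial_integral_ball_gt0_lty.
set h := (fun x => f x * _).
have h0 x : 0 <= h x by rewrite mulr_ge0// exprn_ge0// invr_ge0 norm2_ge0.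
have mh : measurable_fun setT h.
  apply: measurable_funM => //; apply: (measurable_funX (f := fun x => (norm2 x)^-1)).
  exact: measurable_norm2V.
have hh s x : 0 < s -> h (scale_rn s x) = h x.
  move=> s0; rewrite /h fk// norm2_scale ?ltW// invfM exprMn exprVn.
  by rewrite mulrACA -exprMn divff ?gt_eqF// expr1n mul1r.
have := @radial_integral_cross R n h (@moment_profile k) (@ball_profile R)
  mh (@measurable_moment_profile k) (@measurable_ball_profile R) h0
  (@moment_profile_ge0 k) (@ball_profile_ge0 R) hh (moment_profile0 k) (ball_profile0 (R:=R)).
move: (radial_integral one ball_profile) => [b| |]//= cross b0 boo.
have {}cross := cross (introT andP (conj b0 boo)).
rewrite lte_fin in b0.
have nb : n%:R * b != 0 by rewrite mulf_neq0 ?pnatr_eq0 -?lt0n// gt_eqF.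
rewrite muleCA [X in (_ * X)%E]muleCA [(radial_integral one _ * _)%E]muleC -cross.
rewrite [(radial_integral h _ * _)%E]muleC !muleA -!EFinM.
by rewrite -mulrA mulVf// mul1e.
Qed.

(** Positive and negative parts of a homogeneous function are homogeneous, as
    only dilations by positive factors are considered.  Finiteness on the sphere
    keeps the difference of the two integrals meaningful. *)
Lemma gaussian_homogeneous k f v : measurable_fun setT f -> homogeneous k f ->
  (\int[mu]_(x in sphere) (f x)%:E = v%:E)%E ->
  (\int[rho]_x (f x)%:E =
   (fine (\int[rho]_x (norm2 x ^+ k)%:E) * v)%:E)%E.
Proof.
move=> mf fk fv.
pose fp x := Num.max (f x) 0; pose fm x := Num.max (- f x) 0.
have mfp : measurable_fun setT fp by exact: measurable_funrpos.
have mfm : measurable_fun setT fm by exact: measurable_funrneg.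
have fp0 x : 0 <= fp x by rewrite le_max lexx orbT.
have fm0 x : 0 <= fm x by rewrite le_max lexx orbT.
have hp : homogeneous k fp.
  by move=> s x s0; rewrite /fp fk// maxr_pMr ?exprn_ge0 ?ltW// mulr0.
have hm : homogeneous k fm.
  by move=> s x s0; rewrite /fm fk// -mulrN maxr_pMr ?exprn_ge0 ?ltW// mulr0.
have E (nu : {measure set (n.-tuple R) -> \bar R}) D :
    (\int[nu]_(x in D) (f x)%:E =
     \int[nu]_(x in D) (fp x)%:E - \int[nu]_(x in D) (fm x)%:E)%E.
  rewrite integralE; congr (_ - _)%E; apply: eq_integral => x _.
    by rewrite funeposE EFin_max.
  by rewrite funenegE EFin_max.
have := fin_numB (\int[mu]_(x in sphere) (fp x)%:E) (\int[mu]_(x in sphere) (fm x)%:E).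
rewrite -E fv/= => /esym/andP[finp finm].
rewrite E (ge0_gaussian_homogeneous mfp fp0 hp) (ge0_gaussian_homogeneous mfm fm0 hm).
have finc : (\int[rho]_x (norm2 x ^+ k)%:E)%E \is a fin_num.
  rewrite ge0_fin_numE ?gaussian_moment_lty//; apply: integral_ge0 => x _.
  by rewrite lee_fin exprn_ge0 ?norm2_ge0.
rewrite -muleBr//; last by rewrite fin_num_adde_defr.
by rewrite -E fv EFinM fineK.
Qed.

(** A dilation reduces this to the unit ball, whose volume is the area of the
    sphere up to the factor [n]. *)
Lemma lebesgue_ball_neq0 b : 0 < b -> leb [set x | 0 < norm2 x <= b] != 0%E.
Proof.
move=> b0.
have mb : measurable [set x : n.-tuple R | 0 < norm2 x <= b].
  rewrite (_ : [set _ | _] = (@norm2 R n) @^-1` `]0, b]).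
    by rewrite -[X in measurable X]setTI; exact: measurable_norm2.
  by apply/seteqP; split => x /=; rewrite in_itv.
rewrite -[X in X != _]mul1e -[X in (_ * leb X)%E]setIT.
rewrite -integral_indic// mul1e (@ge0_integral_scale_rn_EFin _ _ b)//.
under eq_integral do rewrite EFinM.
have mi : measurable_fun setT
    (fun x : n.-tuple R => \1_[set y | 0 < norm2 y <= b] (scale_rn b x) : R).
  apply: (measurableT_comp (measurable_indic mb)); exact: measurable_scale_rn.
rewrite ge0_integralZl//; last 2 first.
- exact/measurable_EFinP.
- by rewrite lee_fin exprn_ge0// ltW.
have -> : (\int[leb]_x (\1_[set x | (0 < norm2 x <= b)%R] (scale_rn b x))%:E =
    radial_integral one (@ball_profile R))%E.
  apply: eq_integral => x _; congr EFin; rewrite mul1r /ball_profile !indicE.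
  congr (nat_of_bool _)%:R; apply/idP/idP; rewrite !inE/= in_itv/= (norm2_scale _ (ltW b0));
  by rewrite pmulr_rgt0// ger_pMr.
have /andP[r0 _] := radial_integral_ball_gt0_lty.
by rewrite mule_eq0 negb_or gt_eqF ?lte_fin ?exprn_gt0// gt_eqF.
Qed.

Lemma integrable_gaussian_norm2X k : rho.-integrable setT (fun x => (norm2 x ^+ k)%:E).
Proof.
apply/integrableP; split.
  by apply/measurable_EFinP; apply: measurable_funX; exact: measurable_norm2.
apply: le_lt_trans (gaussian_moment_lty n k).
under eq_integral do rewrite gee0_abs ?lee_fin ?exprn_ge0 ?norm2_ge0//.
exact: lexx.
Qed.

Lemma integral_gaussian_horner (p : {poly R}) :
  (\int[rho]_x (p.[norm2 x])%:E =
   (\sum_(i < size p) p`_i * fine (\int[rho]_x (norm2 x ^+ i)%:E))%:E)%E.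
Proof.
under eq_integral do rewrite horner_coef -sumEFin.
rewrite integral_sum//; last first.
  move=> i; under eq_fun do rewrite EFinM.
  by apply: integrableZl => //; exact: integrable_gaussian_norm2X.
rewrite -sumEFin; apply: eq_bigr => i _.
under eq_integral do rewrite EFinM.
rewrite integralZl//; last exact: integrable_gaussian_norm2X.
rewrite EFinM fineK//.
by have := integrable_fin_num measurableT (integrable_gaussian_norm2X i).
Qed.

(** The sum is the integral of [p.[|x|]] against the Gaussian measure.  If this
    integral were zero, then [p.[|x|]] would vanish almost everywhere, whereas it
    has no zero in a small punctured ball around the origin. *)
Lemma gaussian_moment_functional_gt0 (p : {poly R}) :
  p != 0 -> (forall r, 0 < r -> 0 <= p.[r]) ->
  0 < \sum_(i < size p) p`_i * fine (\int[rho]_x (norm2 x ^+ i)%:E)%E.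
Proof.
move=> p0 pge0.
have mp : measurable_fun setT (fun x : n.-tuple R => p.[norm2 x]).
  apply: (measurableT_comp _ (@measurable_norm2 R n)).
  by apply: continuous_measurable_fun; exact: continuous_horner.
have pN0 x : 0 <= p.[norm2 x].
  have [x0|x0|x0] := ltrgt0P (norm2 x).
  - exact: pge0.
  - by move: x0; rewrite ltNge norm2_ge0.
  - by rewrite x0; exact: horner0_ge0.
rewrite -lte_fin -integral_gaussian_horner lt0e.
rewrite integral_ge0 ?andbT; last by move=> x _; rewrite lee_fin.
rewrite ge0_integral_gaussian//.
have [b b0 pb] := no_small_root p0.
apply: contra (lebesgue_ball_neq0 b0) => /eqP I0.
have mg : measurable_fun setT (fun x => (gauss_profile (norm2 x) * p.[norm2 x])%:E).
  apply/measurable_EFinP/measurable_funM => //.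
  exact: (measurableT_comp measurable_gauss_profile (@measurable_norm2 R n)).
have [N [mN N0 subN]] : ae_eq leb setT
    (fun x => (gauss_profile (norm2 x) * p.[norm2 x])%:E) (cst 0%E).
  apply/ae_eq_integral_abs => //.
  rewrite -[RHS]I0; apply: eq_integral => x _.
  by rewrite gee0_abs// lee_fin mulr_ge0// expR_ge0.
rewrite eq_le measure_ge0 andbT -N0; apply: le_measure; rewrite ?inE//.
  rewrite (_ : [set _ | _] = (@norm2 R n) @^-1` `]0, b]).
    by rewrite -[X in measurable X]setTI; exact: measurable_norm2.
  by apply/seteqP; split => x /=; rewrite in_itv.
move=> x/= xb; apply: subN => /= /(_ I) /eqP.
rewrite eqe mulf_eq0 gt_eqF ?expR_gt0//=.
by apply/negP; exact: pb.
Qed.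

End homogeneous.

(** * From spherical to Gaussian designs *)

Section monomials.
Context {R : realType} {n : nat}.
Implicit Types (x : n.-tuple R) (m : multinom n).

Definition monomial m x : R := \prod_(i < n) tnth x i ^+ m i.

Lemma measurable_monomial m : measurable_fun setT (monomial m).
Proof.
apply: measurable_prod => i _; apply: measurable_funX; exact: measurable_tnth.
Qed.

Lemma homogeneous_monomial m : homogeneous (mdeg m) (monomial m).
Proof.
move=> s x _; rewrite /monomial mdegE -prodrXr -big_split.
by apply: eq_bigr => i _; rewrite tnth_mktuple exprMn.
Qed.

Lemma norm_tnth_le_norm2 x i : `|tnth x i| <= norm2 x.
Proof.
rewrite -ler_sqr ?nnegrE ?norm2_ge0// /norm2 sqr_sqrtr; last first.
  by apply: sumr_ge0 => j _; exact: sqr_ge0.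
rewrite real_normK ?num_real// (bigD1 i)//= lerDl sumr_ge0// => j _.
exact: sqr_ge0.
Qed.

Lemma norm_monomial_le m x : `|monomial m x| <= norm2 x ^+ mdeg m.
Proof.
rewrite /monomial normr_prod mdegE -prodrXr; apply: ler_prod => i _.
by rewrite normr_ge0 normrX lerXn2r ?nnegrE ?normr_ge0 ?norm2_ge0 ?norm_tnth_le_norm2.
Qed.

Lemma integrable_gaussian_monomial m :
  (@gaussian_measure R n).-integrable setT (EFin \o monomial m).
Proof.
apply: (le_integrable measurableT _ _ (integrable_gaussian_norm2X (mdeg m))).
  by apply/measurable_EFinP; exact: measurable_monomial.
move=> x _ /=; rewrite lee_fin [X in _ <= X]ger0_norm ?exprn_ge0 ?norm2_ge0//.
exact: norm_monomial_le.
Qed.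

Lemma meval_monomial x (p : mpoly n R) :
  meval (tnth x) p = \sum_(m <- msupp p) mcoeff m p * monomial m x.
Proof. exact: mevalE. Qed.

Lemma meval_mpolyX m x : meval (tnth x) (mpolyX R m) = monomial m x.
Proof. exact: mevalX. Qed.

End monomials.

Section designs.
Context {R : realType} {d : nat}.
Variables (t : nat) (X : {fset d.-tuple R}) (w : d.-tuple R -> R).
Hypothesis X0 : (0 < #|` X|%fset)%N.
Hypothesis design : weighted_spherical_design t X w.

Local Notation sphere := (@unit_sphere R d).
Local Notation sigma := (@surface_measure R d).
Local Notation mu := (@sphere_measure R d).
Local Notation rho := (@gaussian_measure R d).

Lemma design_monomial m : (mdeg m <= t)%N ->
  (\int[mu]_(x in sphere) (monomial m x)%:E = (\sum_(x <- X) w x * monomial m x)%:E)%E.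
Proof.
move=> mt; have [_ _ /(_ (mpolyX R m))] := design.
rewrite mmeasureX ltnS => /(_ mt) H.
transitivity (\int[mu]_(x in sphere) (meval (tnth x) (mpolyX R m))%:E)%E.
  by apply: eq_integral => x _; rewrite meval_mpolyX.
by rewrite -H; congr EFin; apply: eq_bigr => x _; rewrite meval_mpolyX.
Qed.

(** If the area of the sphere were zero or infinite, its normalized measure would
    be zero, but the constant polynomial [1] shows that its total mass is the sum
    of the weights. *)
Lemma design_surface_gt0_lty : (0 < sigma sphere < +oo)%E.
Proof.
have := @design_monomial (@mnm0 _); rewrite mdeg0 => /(_ isT).
have m1 (x : d.-tuple R) : monomial (@mnm0 _) x = 1.
  by rewrite /monomial big1// => i _; rewrite mnm0E expr0.
under eq_integral do rewrite m1.
under eq_bigr do rewrite m1 mulr1.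
rewrite integral_cst ?mul1e; last exact: measurable_unit_sphere.
have W0 : 0 < \sum_(x <- X) w x.
  have [_ wX _] := design.
  have [x xX] := fset0Pn _ (ltac:(by rewrite -cardfs_gt0) : X != fset0).
  rewrite (big_rem x)//= ltr_wpDr ?wX// big_seq sumr_ge0// => y /mem_rem yX.
  by rewrite ltW ?wX.
move=> muE; have {}muE : ((fine (sigma sphere))^-1%:E * sigma sphere =
  (\sum_(x <- X) w x)%:E)%E by exact: muE.
have : (0 <= sigma sphere)%E by exact: measure_ge0.
move: muE; case: (sigma sphere) => [r|/=|//].
  rewrite lee_fin le_eqVlt => muE /predU1P[r0|r0]; last by rewrite lte_fin r0 ltry.
  by move: muE; rewrite -r0 mule0 => -[W00]; move: W0; rewrite -W00 ltxx.
by rewrite invr0 mul0e => -[W00] _; exfalso; move: W0; rewrite -W00 ltxx.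
Qed.

Definition dilates (s : seq R) : seq (d.-tuple R) :=
  [seq scale_rn a x | a <- s, x <- X].

Lemma norm2_dilate a x : 0 < a -> x \in X -> norm2 (scale_rn a x) = a.
Proof.
move=> a0 xX; have [XS _ _] := design.
by rewrite norm2_scale ?ltW// (XS x xX : norm2 x = 1) mulr1.
Qed.

Lemma direction_dilate a x : 0 < a -> x \in X -> direction (scale_rn a x) = x.
Proof.
move=> a0 xX; rewrite /direction norm2_dilate// scale_rnA mulVf ?gt_eqF//.
exact: scale_rn1.
Qed.

Lemma dilates_uniq s : uniq s -> {in s, forall a, 0 < a} -> uniq (dilates s).
Proof.
move=> us s0; apply: allpairs_uniq => //; first exact: fset_uniq.
move=> _ _ /allpairsP[[a x] [/= /s0 a0 xX ->]] /allpairsP[[b y] [/= /s0 b0 yX ->]] /= E.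
have ab : a = b by rewrite -(norm2_dilate a0 xX) E norm2_dilate.
by rewrite -(direction_dilate a0 xX) E direction_dilate// ab.
Qed.

(** The weight of a point of the new design is read off from its norm and its
    direction, which recover the radius and the point of the sphere. *)
Lemma gaussian_design_of_spherical : exists (Y : {fset d.-tuple R}) (u : d.-tuple R -> R),
  (#|` Y|%fset <= t.+1 * #|` X|%fset)%N /\ weighted_gaussian_design t Y u.
Proof.
have /andP[sigma_gt0 sigma_lty] := design_surface_gt0_lty.
have [s [v [us ss sv qs]]] := @gauss_quadrature R
  (fun k => fine (\int[rho]_x (norm2 x ^+ k)%:E)%E) t.+1
  (gaussian_moment_functional_gt0 sigma_gt0 sigma_lty).
have s0 : {in s, forall a, 0 < a} by move=> a /sv[].
pose u y := v (norm2 y) * w (direction y).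
pose Y := seq_fset tt (dilates s).
have pY : perm_eq Y (dilates s) 
    by rewrite -[X in perm_eq _ X]undup_id ?seq_fset_perm ?dilates_uniq.
have big_Y F : \sum_(y <- Y) F y = \sum_(a <- s) \sum_(x <- X) F (scale_rn a x) :> R.
  by rewrite (perm_big _ pY) big_allpairs_dep.
exists Y, u; split; first by rewrite (perm_size pY) size_allpairs ss.
split=> // [y|p pt].
  rewrite (perm_mem pY) => /allpairsP[[a x] [/sv[a0 va] xX ->]]/=.
  have [_ wX _] := design.
  by rewrite /u norm2_dilate// direction_dilate// mulr_gt0// wX.
have moment m : (mdeg m <= t)%N ->
    (\int[rho]_x (monomial m x)%:E = (\sum_(y <- Y) u y * monomial m y)%:E)%E.
  move=> mt; rewrite (gaussian_homogeneous sigma_gt0 sigma_lty (measurable_monomial m)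
    (@homogeneous_monomial R d m) (design_monomial mt)).
  congr EFin; rewrite big_Y -qs ?ltnS// mulr_suml; apply: eq_big_seq => a as_.
  rewrite mulr_sumr; apply: eq_big_seq => x xX; have a0 := s0 _ as_.
  rewrite /u norm2_dilate// direction_dilate// homogeneous_monomial//.
  by ring.
under eq_integral do rewrite meval_monomial -sumEFin.
rewrite integral_sum//; last first.
  move=> m; under eq_fun do rewrite EFinM.
  by apply: integrableZl => //; exact: integrable_gaussian_monomial.
under eq_bigr do rewrite meval_monomial mulr_sumr.
rewrite exchange_big -sumEFin; apply: eq_big_seq => m mp.
under eq_integral do rewrite EFinM.
rewrite integralZl//; last exact: integrable_gaussian_monomial.
rewrite moment; last by rewrite -ltnS (leq_trans (msize_mdeg_lt mp)).
rewrite -EFinM mulr_sumr; congr EFin; apply: eq_bigr => y _.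
by rewrite mulrCA.
Qed.

End designs.

Theorem proposition3p2 (R : realType) (t d N : nat)
  (t_gt0 : (0 < t)%N) (d_gt0 : (0 < d)%N) (N_gt0 : (0 < N)%N) :
  (exists (X : {fset d.-tuple R}) (w : d.-tuple R -> R),
      #|` X|%fset = N /\ weighted_spherical_design t X w) ->
  (exists (X : {fset d.-tuple R}) (w : d.-tuple R -> R),
      (#|` X|%fset <= t.+1 * N)%N /\ weighted_gaussian_design t X w).
Proof.
move=> [X [w [XN design]]]; rewrite -XN in N_gt0 *.
exact: gaussian_design_of_spherical design.
Qed.
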